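(* Suppose $n_{\mathcal Z}+n_{\mathcal U}\ge 3$ and $N=0$ (no initial data). Let $C:\mathcal Z\times\mathcal U\to\mathbb R$ have a Lipschitz continuous gradient with known constant $L_C>0$ and satisfy $\|\nabla C(s)\|\le G$ for all $s\in\mathcal Z\times\mathcal U$, for some known $G>0$. Then the data-driven control algorithm described in the context, run with parameters $\alpha=0$ and $\beta>0$, incurs sublinear cumulative regret: $$\sum_{t=1}^{T}\rho_t\le\widehat M\,T^{1-\frac{2}{n_{\mathcal Z}+n_{\mathcal U}}},$$ where $\widehat M$ is a positive constant that depends on $L_C$, $G$, $\alpha$, $\beta$, and the diameters and dimensions of the sets $\mathcal Z$ and $\mathcal U$.
   Context: Setting. $\mathcal X\subset\mathbb R^{n_{\mathcal X}}$ and $\mathcal U\subset\mathbb R^{n_{\mathcal U}}$ are known, convex and compact. The dynamics are $x_{t+1}=F(x_t,u_t)$ with an unknown map $F:\mathcal X\times\mathcal U\to\mathcal X$. A known context map $\Phi:\mathbb R^{n_{\mathcal X}}\to\mathbb R^{n_{\mathcal Z}}$ ($n_{\mathcal Z}\ge n_{\mathcal X}$) is given, $\mathcal Z=\Phi(\mathcal X)$ is assumed compact, and $z_t=\Phi(x_t)$. The one-step cost is an unknown function $C:\mathcal Z\times\mathcal U\to\mathbb R$. ''$C$ has a Lipschitz continuous gradient with constant $L_C$'' means: $C$ is continuously differentiable on $\mathcal Z\times\mathcal U$ and $\|\nabla C(y)-\nabla C(x)\|\le L_C\|y-x\|$ for all $x,y\in\mathcal Z\times\mathcal U$. $\|\cdot\|$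 is the Euclidean norm. $T$ is the (positive integer) number of control time steps. Data-driven bounds. For $t\ge1$, given past context-control pairs $q_i=(z_i,u_i)$, $i=0,\dots,t-1$, and $\ell(s;C,q)=C(q)+\nabla C(q)\cdot(s-q)$, put $$C_{t-1}^+(s)=\min_{0\le i\le t-1}\Big(\ell(s;C,q_i)+\tfrac{L_C}{2}\|s-q_i\|^2\Big),\qquad C_{t-1}^-(s)=\max_{0\le i\le t-1}\Big(\ell(s;C,q_i)-\tfrac{L_C}{2}\|s-q_i\|^2\Big),$$ and $m_{t,\alpha,\beta}(z,u)=\alpha C_{t-1}^+(z,u)+\beta C_{t-1}^-(z,u)$. Algorithm (with $N=0$). Start from $x_0\in\mathcal X$; since no data is available at time $0$, $u_0\in\mathcal U$ is arbitrary. At each time $t\ge1$, having observed $x_t$ (hence $z_t$), and $C(q_i),\nabla C(q_i)$ for $i<t$, apply a minimizer $u_t$ of $m_{t,\alpha,\beta}(z_t,\cdot)$ over $\mathcal U$; then $x_{t+1}=F(x_t,u_t)$. Regret. $\rho_t=C(z_t,u_t)-\min_{u\in\mathcal U}C(z_t,u)$.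
   Formalization: For nonconvex Z the claim as stated is false (C^- need not lie below C); the formal version therefore requires C to be continuously differentiable with L_C-Lipschitz gradient on the convex hull of Z×U, which is Z×U itself when Z is convex. *)

(* Defs.v *)
From HB Require Import structures.
From mathcomp Require Import all_boot all_order all_algebra.
From mathcomp Require Import all_classical all_reals all_analysis.
Set Implicit Arguments.
Unset Strict Implicit.
Unset Printing Implicit Defensive.
Import Order.TTheory GRing.Theory Num.Theory.
Import numFieldNormedType.Exports.
Local Open Scope classical_set_scope.
Local Open Scope ring_scope.

Definition dotv (R : realType) (n : nat) (v w : 'rV[R]_n) : R :=
  \sum_(i < n) v ord0 i * w ord0 i.

(* The library norm on ['rV[R]_n] is the sup norm, hence a separate Euclidean
   norm; the two induce the same topology. *)
Definition enorm (R : realType) (n : nat) (v : 'rV[R]_n) : R :=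
  Num.sqrt (dotv v v).

Definition diameter (R : realType) (n : nat) (A : set 'rV[R]_n) : R :=
  sup [set enorm (p.1 - p.2) | p in A `*` A].

(* A context-control pair [(z, u)] is encoded as the vector [row_mx z u]. *)
Definition prodset (R : realType) (nZ nU : nat)
    (Z : set 'rV[R]_nZ) (U : set 'rV[R]_nU) : set 'rV[R]_(nZ + nU) :=
  [set s | Z (lsubmx s) /\ U (rsubmx s)].

Definition convex_hull (R : realType) (n : nat) (A : set 'rV[R]_n) :
    set 'rV[R]_n :=
  \bigcap_(K in [set K : set 'rV[R]_n | convex_set K /\ A `<=` K]) K.

Definition taylor1 (R : realType) (n : nat) (C : 'rV[R]_n -> R)
    (gradC : 'rV[R]_n -> 'rV[R]_n) (s q : 'rV[R]_n) : R :=
  C q + dotv (gradC q) (s - q).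

(* [gradC] is a gradient of [C] relative to [S]. When [S] has empty interior
   (as [Phi @` X] typically does when [nX < nZ]) the gradient is not determined
   by [C], which is why it is an explicit argument. *)
Definition gradient_on (R : realType) (n : nat) (S : set 'rV[R]_n)
    (C : 'rV[R]_n -> R) (gradC : 'rV[R]_n -> 'rV[R]_n) : Prop :=
  forall q, S q -> forall eps : R, 0 < eps ->
    \forall s \near within S (nbhs q),
      `|C s - taylor1 C gradC s q| <= eps * enorm (s - q).

Definition lipschitz_gradient_on (R : realType) (n : nat) (S : set 'rV[R]_n)
    (C : 'rV[R]_n -> R) (gradC : 'rV[R]_n -> 'rV[R]_n) (L : R) : Prop :=
  [/\ gradient_on S C gradC,
      {within S, continuous gradC} &
      forall x y, S x -> S y ->
        enorm (gradC y - gradC x) <= L * enorm (y - x)].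

Section DataDrivenBounds.
Context (R : realType) (n : nat).
Variables (C : 'rV[R]_n -> R) (gradC : 'rV[R]_n -> 'rV[R]_n) (L : R).
Variable q : nat -> 'rV[R]_n.

Definition upper_at (s : 'rV[R]_n) (i : nat) : R :=
  taylor1 C gradC s (q i) + L / 2 * enorm (s - q i) ^+ 2.

Definition lower_at (s : 'rV[R]_n) (i : nat) : R :=
  taylor1 C gradC s (q i) - L / 2 * enorm (s - q i) ^+ 2.

(* [Cplus t] and [Cminus t] are $C^+_{t-1}$ and $C^-_{t-1}$, built from
   [q 0, ..., q t.-1], and are meaningful for [0 < t] only: the term of index 0
   serves as the initial value of the iterated min and max, so that no neutral
   element is needed. *)
Definition Cplus (t : nat) (s : 'rV[R]_n) : R :=
  \big[Num.min/upper_at s 0]_(i < t) upper_at s i.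

Definition Cminus (t : nat) (s : 'rV[R]_n) : R :=
  \big[Num.max/lower_at s 0]_(i < t) lower_at s i.

Definition surrogate (alpha beta : R) (t : nat) (s : 'rV[R]_n) : R :=
  alpha * Cplus t s + beta * Cminus t s.

End DataDrivenBounds.

Definition is_minimizer (R : realType) (T : Type) (A : set T) (f : T -> R)
    (a : T) : Prop :=
  A a /\ forall b, A b -> f a <= f b.

Definition pair_at (R : realType) (nX nZ nU : nat)
    (Phi : 'rV[R]_nX -> 'rV[R]_nZ) (x : nat -> 'rV[R]_nX)
    (u : nat -> 'rV[R]_nU) (t : nat) : 'rV[R]_(nZ + nU) :=
  row_mx (Phi (x t)) (u t).

(* [x], [u] is a run of the algorithm, without initial data, up to time [T];
   nothing is required of [x t] and [u t] for [T < t]. *)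
Definition algorithm_run (R : realType) (nX nZ nU : nat)
    (X : set 'rV[R]_nX) (U : set 'rV[R]_nU)
    (F : 'rV[R]_nX -> 'rV[R]_nU -> 'rV[R]_nX)
    (Phi : 'rV[R]_nX -> 'rV[R]_nZ)
    (C : 'rV[R]_(nZ + nU) -> R)
    (gradC : 'rV[R]_(nZ + nU) -> 'rV[R]_(nZ + nU))
    (L alpha beta : R) (T : nat)
    (x : nat -> 'rV[R]_nX) (u : nat -> 'rV[R]_nU) : Prop :=
  [/\ X (x 0%N), U (u 0%N),
      forall t, (t < T)%N -> x t.+1 = F (x t) (u t) &
      forall t, (0 < t <= T)%N ->
        is_minimizer U
          (fun v => surrogate C gradC L (pair_at Phi x u) alpha beta t
                      (row_mx (Phi (x t)) v))
          (u t)].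

(* The infimum is a minimum whenever [U] is compact and nonempty and
   [C (row_mx (Phi (x t)) _)] is continuous on [U]. *)
Definition regret (R : realType) (nX nZ nU : nat) (U : set 'rV[R]_nU)
    (Phi : 'rV[R]_nX -> 'rV[R]_nZ) (C : 'rV[R]_(nZ + nU) -> R)
    (x : nat -> 'rV[R]_nX) (u : nat -> 'rV[R]_nU) (t : nat) : R :=
  C (pair_at Phi x u t) - inf [set C (row_mx (Phi (x t)) v) | v in U].

(* Main.v *)
Require Import Defs.
From HB Require Import structures.
From mathcomp Require Import all_boot all_order all_algebra.
From mathcomp Require Import all_classical all_reals all_analysis.
From mathcomp Require Import ring lra.
Import Order.TTheory GRing.Theory Num.Theory.
Import numFieldNormedType.Exports.
Local Open Scope classical_set_scope.
Local Open Scope ring_scope.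

(* Minimizing [Cminus] makes the regret at time [t] at most the gap
   [C (q t) - Cminus (q t)], and the two sides of the descent lemma bound this
   gap by [L] times the squared distance from [q t] to any earlier [q i].
   These distances cannot stay large: cut a cube containing all the [q t] into
   [2 ^ (n * j)] cells, [n = nZ + nU]. At most [2 ^ (n * j)] times is [q t] the
   first point of its level-[j] cell, and at the other times the squared
   distance to the past is at most of order [4 ^- j]. Summing over the levels
   up to [J] with [2 ^ (n * J)] comparable to [T] gives a sum of order
   [T * 4 ^- J + \sum_(j <= J) 2 ^ ((n - 2) * j)], a geometric sum of ratio at
   least 2 because [3 <= n]. *)

(** * Euclidean inner product and norm; segments in convex sets *)

Section Euclidean.
Context {R : realType} {n : nat}.
Implicit Types (v w x y : 'rV[R]_n) (K : set 'rV[R]_n).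

Lemma dotvC v w : dotv v w = dotv w v.
Proof. by apply: eq_bigr => i _; rewrite mulrC. Qed.

Lemma dotvDl v w x : dotv (v + w) x = dotv v x + dotv w x.
Proof. by rewrite -big_split; apply: eq_bigr => i _; rewrite mxE mulrDl. Qed.

Lemma dotvZl (a : R) v w : dotv (a *: v) w = a * dotv v w.
Proof. by rewrite mulr_sumr; apply: eq_bigr => i _; rewrite mxE mulrA. Qed.

Lemma dotvBl v w x : dotv (v - w) x = dotv v x - dotv w x.
Proof. by rewrite dotvDl -scaleN1r dotvZl mulN1r. Qed.

Lemma dotvZr (a : R) v w : dotv v (a *: w) = a * dotv v w.
Proof. by rewrite dotvC dotvZl dotvC. Qed.

Lemma dotvBr v w x : dotv x (v - w) = dotv x v - dotv x w.
Proof. by rewrite dotvC dotvBl !(dotvC x). Qed.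

Lemma dotvv_ge0 v : 0 <= dotv v v.
Proof. by apply: sumr_ge0 => i _; rewrite -expr2 sqr_ge0. Qed.

Lemma enorm_ge0 v : 0 <= enorm v.
Proof. exact: sqrtr_ge0. Qed.

Lemma sqr_enorm v : enorm v ^+ 2 = dotv v v.
Proof. by rewrite sqr_sqrtr ?dotvv_ge0. Qed.

Lemma enormZ (a : R) v : enorm (a *: v) = `|a| * enorm v.
Proof.
by rewrite /enorm dotvZl dotvZr mulrA -expr2 sqrtrM ?sqr_ge0// sqrtr_sqr.
Qed.

Lemma enorm_eq0 v : enorm v = 0 -> v = 0.
Proof.
move=> v0; have /eqP := sqr_enorm v.
rewrite v0 expr0n eq_sym psumr_eq0; last by move=> i _; rewrite -expr2 sqr_ge0.
move=> /allP v00; apply/rowP => i; rewrite mxE.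
have /eqP := v00 i (mem_index_enum i); rewrite -expr2 => /eqP.
by rewrite sqrf_eq0 => /eqP.
Qed.

(** The squared norm of [enorm w *: v - enorm v *: w] expands to twice [enorm v * enorm w] times the
    difference of the two sides; vanishing norms are treated apart so that this factor can be
    cancelled. *)
Lemma Cauchy_Schwarz v w : dotv v w <= enorm v * enorm w.
Proof.
have [/enorm_eq0 ->|v0] := eqVneq (enorm v) 0.
  by rewrite -(scale0r 0) dotvZl mul0r mulr_ge0 ?enorm_ge0.
have [/enorm_eq0 ->|w0] := eqVneq (enorm w) 0.
  by rewrite -(scale0r 0) dotvZr mul0r mulr_ge0 ?enorm_ge0.
have vw0 : 0 < enorm v * enorm w by rewrite mulr_gt0// lt_def enorm_ge0 andbT.
have := dotvv_ge0 (enorm w *: v - enorm v *: w).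
rewrite dotvBl !dotvBr !dotvZl !dotvZr -!sqr_enorm (dotvC w v) => h.
by rewrite -(ler_pM2l vw0); lra.
Qed.

Lemma normr_dotv_le v w : `|dotv v w| <= enorm v * enorm w.
Proof.
rewrite ler_norml Cauchy_Schwarz andbT lerNl.
have := Cauchy_Schwarz (- v) w.
by rewrite -scaleN1r dotvZl enormZ normrN1 mulN1r mul1r.
Qed.

Lemma coord_le_enorm v (i : 'I_n) : `|v ord0 i| <= enorm v.
Proof.
rewrite -sqrtr_sqr ler_sqrt ?dotvv_ge0// /dotv (bigD1 i)//= expr2 lerDl.
by apply: sumr_ge0 => j _; rewrite -expr2 sqr_ge0.
Qed.

Lemma sqr_enorm_le v (c : R) :
  (forall i, `|v ord0 i| <= c) -> enorm v ^+ 2 <= n%:R * c ^+ 2.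
Proof.
move=> vc; rewrite sqr_enorm mulr_natl -[X in _ *+ X](card_ord n) -sumr_const.
apply: ler_sum => i _; rewrite -expr2 -real_normK ?num_real//.
by rewrite lerXn2r ?nnegrE// (le_trans _ (vc i)).
Qed.

Lemma convex_set_convex_hull K : convex_set (convex_hull K).
Proof.
move=> x y t; rewrite !inE => hx hy B [Bc KB].
by have := Bc x y t; rewrite !inE; apply; [exact: hx | exact: hy].
Qed.

Lemma convex_set_segment K x y (s : R) : convex_set K -> K x -> K y ->
  0 <= s <= 1 -> K (x + s *: (y - x)).
Proof.
move=> cK Kx Ky /andP[s0 s1].
have := cK y x (Itv01 s0 s1); rewrite !inE => /(_ Ky Kx).
suff -> : x + s *: (y - x) =
    @conv _ (convex_lmodType 'rV[R]_n) (Itv01 s0 s1) y x by [].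
rewrite /conv/= /unstable.onem scalerBr scalerBl scale1r.
by rewrite addrCA addrC -!addrA.
Qed.
End Euclidean.

(** * Mean value theorem along a segment *)

(** Turns differentiability relative to [[0, 1]], which [gradient_on] provides along a segment, into
    the hypotheses of [MVT]: a two-sided derivative inside, continuity up to the endpoints. *)
Lemma derive_within_itv {R : realType} (f g : R -> R) :
  (forall s : R, 0 <= s <= 1 -> forall eps : R, 0 < eps ->
    \forall r \near within `[0, 1]%classic (nbhs s),
      `|f r - f s - g s * (r - s)| <= eps * `|r - s|) ->
  (forall s : R, s \in `]0, 1[ -> is_derive s 1 f (g s)) /\
  {within `[0, 1], continuous f}.
Proof.
move=> fg; split.
- move=> s s01; have /andP[s0 s1] : 0 < s < 1 by rewrite in_itv in s01.
  suff H : (fun h => h^-1 *: ((f \o shift s) (h *: (1 : R)) - f s))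
      @ 0^' --> g s.
    by apply: DeriveDef; [apply/cvg_ex; exists (g s) | exact: cvg_lim].
  apply/cvgrPdist_le => eps eps0.
  have s01' : 0 <= s <= 1 by rewrite !ltW.
  have := fg s s01' eps eps0; rewrite near_withinE => /nbhs_ballP[d /= d0 sd].
  (* The bounds [s] and [1 - s] keep [h + s] in [[0, 1]], where the relative estimate applies. *)
  exists (Num.min d (Num.min s (1 - s))) => /=.
    by rewrite !lt_min d0 s0 subr_gt0.
  move=> h /=; rewrite sub0r normrN !lt_min => /and3P[hd hs hs1] h0.
  have := sd (h + s); rewrite /ball/= in_itv/= opprD addrCA subrr addr0 normrN.
  rewrite addrK => /(_ hd).
  have -> : 0 <= h + s <= 1 by move: hs hs1; rewrite !ltr_norml; lra.
  move=> /(_ isT) H.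
  rewrite scaler1 -(ler_pM2r (_ : 0 < `|h|)) ?normr_gt0//.
  rewrite -normrM distrC mulrBl in H *.
  have -> : h^-1 *: (f (h + s) - f s) * h = f (h + s) - f s.
    by rewrite /GRing.scale/= mulrAC mulVf// mul1r.
  done.
- apply/subspace_continuousP => s; rewrite /= in_itv/= => s01.
  apply/cvgrPdist_le => eps eps0.
  have := fg s s01 1 ltr01; rewrite !near_withinE => /nbhs_ballP[d /= d0 sd].
  (* The estimate with constant 1 gives the local bound [(1 + |g s|) * |r - s|] on the increment of
     [f]. *)
  apply/nbhs_ballP; exists (Num.min d (eps / (1 + `|g s|))) => /=.
    by rewrite lt_min d0 divr_gt0// ltr_wpDr.
  move=> r; rewrite /ball/= lt_min => /andP[rd re] r01.
  have := sd r rd r01; rewrite mul1r => H.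
  rewrite ltr_pdivlMr ?ltr_wpDr// in re.
  rewrite distrC -[f r - f s](subrK (g s * (r - s))).
  rewrite (le_trans (ler_normD _ _))// (le_trans _ (ltW re))//.
  by rewrite [leRHS]mulrDr mulr1 lerD// ?normrM ?(distrC s)// mulrC.
Qed.

(* The two inequalities of the descent lemma are [b = L / 2] and
   [b = - L / 2] times the squared norm of [y - x]. *)
Lemma descent_MVT {R : realType} {n : nat} (K : set 'rV[R]_n)
    (C : 'rV[R]_n -> R) (gradC : 'rV[R]_n -> 'rV[R]_n) (x y : 'rV[R]_n)
    (b : R) :
  convex_set K -> gradient_on K C gradC -> K x -> K y ->
  exists2 c : R, 0 < c < 1 & C y - taylor1 C gradC y x - b =
    dotv (gradC (x + c *: (y - x)) - gradC x) (y - x) - 2 * b * c.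
Proof.
move=> cK CK Kx Ky; set h := y - x.
pose p (s : R) := x + s *: h.
pose f s := C (p s); pose g s := dotv (gradC (p s)) h.
have pB r s : p r - p s = (r - s) *: h.
  by rewrite /p opprD addrACA subrr add0r -scalerBl.
have pc : continuous p.
  move=> s; apply: cvgD; first exact: cvg_cst.
  exact: (cvgZr_tmp (a := h) (@cvg_id _ (nbhs s))).
have [fd fc] : (forall s : R, s \in `]0, 1[ -> is_derive s 1 f (g s)) /\
    {within `[0, 1], continuous f}.
  apply: derive_within_itv => s s01 eps eps0.
  have Kp r : 0 <= r <= 1 -> K (p r) by exact: convex_set_segment.
  (* Distances along the segment are [enorm h] times those of the parameter; adding 1 covers
     [h = 0]. *)
  have h0 : 0 < eps / (1 + enorm h) by rewrite divr_gt0// ltr_wpDr// enorm_ge0.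
  have := CK _ (Kp s s01) _ h0; rewrite near_withinE => /(pc s) Hs.
  have {}Hs : \forall r \near s, K (p r) ->
      `|C (p r) - taylor1 C gradC (p r) (p s)| <= eps / (1 + enorm h) * enorm (p r - p s) by exact: Hs.
  have /nbhs_ballP[d /= d0 sd] := Hs.
  rewrite near_withinE; apply/nbhs_ballP; exists d => // r /sd H.
  rewrite /= in_itv/= => r01; have {H}H1 := H (Kp r r01).
  move: H1; rewrite /taylor1 pB dotvZr enormZ opprD addrA => H1.
  rewrite [g s * _]mulrC (le_trans H1)//.
  rewrite mulrAC -mulrA ler_wpM2l ?(ltW eps0)// -mulrA ler_piMr//.
  by rewrite ler_pdivrMr ?mul1r ?lerDr// ltr_wpDr// enorm_ge0.
(* [F 1 - F 0] is the left-hand side of the claim, and [G c] its right-hand side. *)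
pose F s := f s - (dotv (gradC x) h * s + b * s ^+ 2).
pose G s := g s - (dotv (gradC x) h + b * (2 * s)).
have Fd : forall s : R, s \in `]0, 1[ -> is_derive s 1 F (G s).
  move=> s /fd fs; rewrite /F /G; apply: is_deriveB.
  by apply: is_derive_eq; rewrite /GRing.scale/=; ring.
have Fc : {within `[0, 1], continuous F}.
  have qc : continuous (fun s : R => dotv (gradC x) h * s + b * s ^+ 2).
    move=> s; apply: cvgD; apply: cvgMl_tmp; first exact: cvg_id.
    exact: exprn_continuous.
  by move=> s; apply: cvgB; [exact: fc|exact: (continuous_subspaceT qc)].
have [c] := MVT ltr01 Fd Fc.
rewrite in_itv/= => c01 Fe; exists c => //.
move: Fe; rewrite /F /G /f /g /p scale1r scale0r addr0 subrKC.
rewrite /taylor1 -/h dotvBl.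
lra.
Qed.

(** * Counting first visits; choice of the dyadic scale *)

(** [g] is injective on the times of first occurrence: of two times with the same value, the later
    one is not a first occurrence. *)
Lemma count_first_occurrences {A : finType} (g : nat -> A) (T : nat) :
  (\sum_(t < T) [forall i : 'I_t, g i != g t] <= #|A|)%N.
Proof.
rewrite -big_mkcond /= sum1_card.
rewrite -(card_in_imset (f := fun t : 'I_T => g t)) ?max_card// => s t.
rewrite !unfold_in => /forallP/= gs /forallP/= gt gst; apply: val_inj => /=.
case: (ltngtP s t) => // st.
- by have := gt (Ordinal st); rewrite gst eqxx.
- by have := gs (Ordinal st); rewrite -gst eqxx.
Qed.

Lemma exists_dyadic_level (R : realType) (n T : nat) : (3 <= n)%N -> (0 < T)%N ->
  exists J : nat,
    T%:R * (4^-1) ^+ J <= 4 * T%:R `^ (1 - 2 / n%:R) :> R /\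
    (2 ^ (n - 2))%:R ^+ J <= T%:R `^ (1 - 2 / n%:R) :> R.
Proof.
move=> n3 T0; have n0 : (0 < n)%N by apply: leq_trans n3.
have n1 : (1 < 2 ^ n)%N by rewrite -{1}(expn0 2) ltn_exp2l.
(* So [(2 ^ n) ^ J <= T < (2 ^ n) ^ (J + 1)]. The upper bound raised to [2 / n] gives the first
   claim, the 4 paying for the rounding; the lower bound raised to [1 - 2 / n] gives the second. *)
pose J := trunc_log (2 ^ n) T; exists J.
have nR : n%:R != 0 :> R by rewrite pnatr_eq0 -lt0n.
have T0R : 0 < T%:R :> R by rewrite ltr0n.
have pow2 k (a : R) : ((2 ^ n) ^ k)%:R `^ a = 2 `^ (n%:R * k%:R * a) :> R.
  by rewrite -expnM natrX -powR_mulrn// -powRrM natrM.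
split.
- have h : T%:R `^ (2 / n%:R) <= 4 * 4 ^+ J :> R.
    have -> : 4 * 4 ^+ J = ((2 ^ n) ^ J.+1)%:R `^ (2 / n%:R) :> R.
      rewrite pow2 -mulrA mulrCA (mulrCA n%:R) divff// mulr1 -natrM.
      by rewrite powR_mulrn// mulnC exprM -exprS; congr (_ ^+ _); ring.
    rewrite ge0_ler_powR ?nnegrE ?ler0n ?divr_ge0//.
    by rewrite ler_nat ltnW// trunc_log_ltn.
  rewrite powRB ?T0R ?pnatr_eq0 -?lt0n ?T0 ?implybT// powRr1 ?ler0n// mulrA.
  rewrite ler_pdivlMr ?powR_gt0// exprVn mulrAC ler_pdivrMr ?exprn_gt0//.
  by rewrite [4 * _]mulrC -mulrA ler_pM2l.
- have -> : (2 ^ (n - 2))%:R ^+ J = ((2 ^ n) ^ J)%:R `^ (1 - 2 / n%:R) :> R.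
    rewrite pow2.
    have -> : n%:R * J%:R * (1 - 2 / n%:R) = ((n - 2) * J)%:R :> R.
      by rewrite natrM natrB 1?ltnW//; field.
    by rewrite powR_mulrn// exprM natrX.
  rewrite ge0_ler_powR ?nnegrE ?ler0n//.
    by rewrite subr_ge0 ler_pdivrMr ?ltr0n// mul1r ler_nat ltnW.
  by rewrite ler_nat trunc_logP.
Qed.

Lemma geometric_sum_le (R : realDomainType) (r : R) (J : nat) : 2 <= r ->
  \sum_(j < J) r ^+ j.+1 <= 2 * r ^+ J.
Proof.
move=> r2; have r0 : 0 <= r by apply: le_trans r2.
elim: J => [|J IH]; first by rewrite big_ord0 mulr1.
rewrite big_ord_recr/=; have := exprn_ge0 J r0; rewrite exprS => rJ.
have := ler_wpM2r rJ r2; lra.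
Qed.

(** * Dyadic packing of a bounded sequence *)

Section Packing.
Context {R : realType} {n : nat} (q : nat -> 'rV[R]_n) (D : R) (T : nat).
Hypothesis D0 : 0 < D.
Hypothesis qD : forall t (i : 'I_n), (t <= T)%N ->
  `|q t ord0 i - q 0 ord0 i| < D.

(* The cube of side [2 * D] centred at [q 0] is divided into [2 ^ j] slices
   along each axis. *)
Let slice (j t : nat) (i : 'I_n) : R :=
  (2 ^ j)%:R * ((q t ord0 i - q 0 ord0 i + D) / (2 * D)).

(** The form [.-1.+1] provides the successor that [inord] expects. The strict bound [qD] keeps the
    truncation below [2 ^ j], so up to time [T] the default of [inord] is never taken. *)
Let cell (j t : nat) : {ffun 'I_n -> 'I_(2 ^ j).-1.+1} :=
  [ffun i => inord (Num.truncn (slice j t i))].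

Let slice_bounds (j t : nat) (i : 'I_n) : (t <= T)%N ->
  0 <= slice j t i < (2 ^ j)%:R.
Proof.
move=> tT; have := qD t i tT; rewrite ltr_norml => /andP[h1 h2].
have p0 : 0 < (2 ^ j)%:R :> R by rewrite ltr0n expn_gt0.
rewrite mulr_ge0 ?ltW ?divr_gt0 ?mulr_gt0//=; last lra.
rewrite -[ltRHS]mulr1 ltr_pM2l// ltr_pdivrMr ?mulr_gt0//; lra.
Qed.

(** Equal truncations put the slices within 1 of each other, hence each pair of coordinates within
    the cell width [2 * D / 2 ^ j]. *)
Lemma same_cell_dist (j s t : nat) : (s <= T)%N -> (t <= T)%N ->
  cell j s = cell j t ->
  enorm (q t - q s) ^+ 2 <= (4 * n%:R * D ^+ 2) * (4^-1) ^+ j.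
Proof.
move=> sT tT /ffunP st.
have p0 : 0 < (2 ^ j)%:R :> R by rewrite ltr0n expn_gt0.
suff H i : `|(q t - q s) ord0 i| <= 2 * D / (2 ^ j)%:R.
  have e : 4 ^+ j = (2 ^ j)%:R ^+ 2 :> R.
    by rewrite natrX -exprM mulnC exprM; congr (_ ^+ _); ring.

  apply: (le_trans (sqr_enorm_le _ _ H)); rewrite exprVn e.
  have p1 : (2 ^ j)%:R != 0 :> R by rewrite gt_eqF.
  by rewrite le_eqVlt; apply/orP; left; apply/eqP; field.
have [s0 s1] := andP (slice_bounds j s i sT).
have [t0 t1] := andP (slice_bounds j t i tT).
have := st i; rewrite !ffunE => /(congr1 (@nat_of_ord _)).
rewrite !inordK ?prednK ?expn_gt0 ?truncn_lt_nat//.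
move: (truncn_itv s0) (truncn_itv t0) => /andP[a1 a2] /andP[b1 b2] e.
rewrite e in a1 a2; rewrite !mxE.
have : `|slice j t i - slice j s i| <= 1.
  by rewrite ler_norml -natr1 in a2 b2 *; lra.
rewrite /slice -mulrBr -mulrBl normrM (gtr0_norm p0) mulrC.
rewrite -ler_pdivlMr// normrM.
rewrite [in X in _ * X]gtr0_norm ?invr_gt0 ?mulr_gt0// ler_pdivrMr ?mulr_gt0//.
rewrite mul1r mulrC => /(le_trans _); apply.
by rewrite le_eqVlt; apply/orP; left; apply/eqP; congr (`|_|); ring.
Qed.

Let novel (j t : nat) : bool := [forall i : 'I_t, cell j i != cell j t].

Lemma sum_novel (j : nat) :
  \sum_(1 <= t < T.+1) (novel j t)%:R <= (2 ^ (n * j))%:R :> R.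
Proof.
rewrite -natr_sum ler_nat.
(* Time 0 is put back so that the count of first occurrences applies. *)
apply: (@leq_trans (\sum_(0 <= t < T.+1) novel j t)%N).
  by rewrite [leqRHS]big_ltn// leq_addl.
rewrite big_mkord; apply: leq_trans (count_first_occurrences (cell j) T.+1) _.
by rewrite card_ffun !card_ord prednK ?expn_gt0// -expnM mulnC.
Qed.

(** Induction on [J]. If the cell of level [J + 1] was visited before, an earlier point in it gives
    the finer bound; otherwise the old witness stays, and its bound [4 ^- J] becomes the new summand
    [j = J]. *)
Lemma nearest_dist_le (J t : nat) : (0 < t <= T)%N ->
  exists2 i, (i < t)%N & enorm (q t - q i) ^+ 2 <= (4 * n%:R * D ^+ 2) *
    ((4^-1) ^+ J + \sum_(j < J) (novel j.+1 t)%:R * (4^-1) ^+ j).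
Proof.
move=> /andP[t0 tT]; set c := 4 * _ * _.
have c0 : 0 <= c by rewrite mulr_ge0 ?sqr_ge0// mulr_ge0.
have old j : ~~ novel j t ->
    exists2 i, (i < t)%N & enorm (q t - q i) ^+ 2 <= c * (4^-1) ^+ j.
  rewrite negb_forall => /existsP[i]; rewrite negbK => /eqP it.
  exists i => //; apply: same_cell_dist => //.
  by apply: leq_trans tT; apply: ltnW.
(* Level 0 has a single cell, already visited at time 0. *)
have n0 : ~~ novel 0 t.
  rewrite negb_forall; apply/existsP; exists (Ordinal t0); rewrite negbK.
  apply/eqP/ffunP => i; apply/val_inj.
  by move: (_ i) (cell 0 t i) => [[]//= ?] [[]].
elim: J => [|J [i it IH]].
  by have [i it H] := old 0 n0; exists i; rewrite // big_ord0 addr0.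
have [nJ|oJ] := boolP (novel J.+1 t); last first.
  have [k kt H] := old _ oJ; exists k => //; apply: (le_trans H).
  rewrite ler_wpM2l// lerDl; apply: sumr_ge0 => j _.
  by rewrite mulr_ge0// exprn_ge0// invr_ge0.
exists i => //; apply: (le_trans IH); rewrite ler_wpM2l//.
rewrite big_ord_recr/= nJ mul1r [X in _ <= _ + X]addrC lerDr.
by rewrite exprn_ge0// invr_ge0.
Qed.

Lemma sum_nearest_dist_le (L : R) (rho : nat -> R) : (3 <= n)%N -> (0 < T)%N ->
  0 <= L ->
  (forall t i, (t <= T)%N -> (i < t)%N ->
    rho t <= L * enorm (q t - q i) ^+ 2) ->
  \sum_(1 <= t < T.+1) rho t <=
    L * (48 * n%:R * D ^+ 2) * T%:R `^ (1 - 2 / n%:R).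
Proof.
move=> n3 T0 L0 rhoL; have [J [HJ1 HJ2]] := exists_dyadic_level R _ _ n3 T0.
set P := powR _ _ in HJ1 HJ2 *; set c := 4 * n%:R * D ^+ 2.
have c0 : 0 <= c by rewrite mulr_ge0 ?sqr_ge0// mulr_ge0.
apply: (@le_trans _ _ (\sum_(1 <= t < T.+1) L * (c *
    ((4^-1) ^+ J + \sum_(j < J) (novel j.+1 t)%:R * (4^-1) ^+ j)))).
  rewrite big_nat [leRHS]big_nat; apply: ler_sum => t; rewrite ltnS => tT.
  have [i it H] := nearest_dist_le J t tT; apply: (le_trans (rhoL _ _ _ it)).
    by case/andP: tT.
  exact: ler_wpM2l.
rewrite -!mulr_sumr -mulrA ler_wpM2l//.
have -> : 48 * n%:R * D ^+ 2 * P = c * (12 * P) by rewrite /c; ring.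
rewrite ler_wpM2l// big_split/= sumr_const_nat subSS subn0.
(* [4 * P] bounds the finest-scale term [T * 4 ^- J], and [8 * P] the sum over the levels. *)
have -> : 12 * P = 4 * P + 8 * P by ring.
apply: lerD; first by rewrite -[leLHS]mulr_natl.
rewrite exchange_big/=.
(* The [2 ^ (n * (j + 1))] first visits, each of weight [4 ^- j], cost
   [4 * (2 ^ (n - 2)) ^ (j + 1)]. *)
apply: (@le_trans _ _ (\sum_(j < J) 4 * (2 ^ (n - 2))%:R ^+ j.+1)).
  apply: ler_sum => j _; rewrite -mulr_suml.
  apply: (@le_trans _ _ ((2 ^ (n * j.+1))%:R * (4^-1) ^+ j)).
    by rewrite ler_wpM2r ?sum_novel// exprn_ge0// invr_ge0.
  rewrite -{1}(subnK (ltnW n3)) mulnDl expnD -natrX -expnM natrM -mulrA.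
  rewrite mulrC ler_wpM2r// expnM natrX exprS.
  by rewrite -mulrA -exprMn mulfV ?expr1n ?mulr1.
rewrite -mulr_sumr.
have -> : 8 * P = 4 * (2 * P) by ring.
rewrite ler_pM2l//; apply: (le_trans (geometric_sum_le _ _ _ _)).
  by rewrite ler_nat -{1}(expn1 2) leq_exp2l// subn_gt0.
by rewrite ler_pM2l.
Qed.

End Packing.

(** * Descent lemma and diameters *)

(** With [b = L / 2 * e] in [descent_MVT], the inner product at the intermediate point is at most
    [L * c * e = 2 * b * c], so the right-hand side is nonpositive; [- b] gives the other side. *)
Lemma descent_lemma {R : realType} {n : nat} (K : set 'rV[R]_n)
    (C : 'rV[R]_n -> R) (gradC : 'rV[R]_n -> 'rV[R]_n) (L : R)
    (x y : 'rV[R]_n) :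
  convex_set K -> lipschitz_gradient_on K C gradC L -> K x -> K y ->
  `|C y - taylor1 C gradC y x| <= L / 2 * enorm (y - x) ^+ 2.
Proof.
move=> cK [CK _ CL] Kx Ky; set e := enorm (y - x) ^+ 2.
have key c : 0 < c < 1 ->
    `|dotv (gradC (x + c *: (y - x)) - gradC x) (y - x)| <= L * c * e.
  move=> /andP[c0 c1]; apply: (le_trans (normr_dotv_le _ _)).
  rewrite /e expr2 [leRHS]mulrA ler_wpM2r ?enorm_ge0//.
  have Kc : K (x + c *: (y - x)) by apply: convex_set_segment; rewrite // !ltW.
  apply: (le_trans (CL _ _ Kx Kc)).
  by rewrite addrAC subrr add0r enormZ gtr0_norm// mulrA.
rewrite ler_norml; apply/andP; split.
- have [c c01] := descent_MVT K C gradC x y (- (L / 2 * e)) cK CK Kx Ky.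
  have := key c c01; rewrite ler_norml; lra.
- have [c c01] := descent_MVT K C gradC x y (L / 2 * e) cK CK Kx Ky.
  have := key c c01; rewrite ler_norml; lra.
Qed.

Lemma coord_le_mx_norm {R : realType} {n : nat} (v : 'rV[R]_n) (i : 'I_n) :
  `|v ord0 i| <= `|v|.
Proof.
rewrite [leRHS]/Num.Def.normr/= mx_normrE.
by apply/bigmax_geP; right; exists (ord0, i).
Qed.

(** Compactness bounds the set of distances, so that [sup] is a genuine upper bound; the library
    bound is in the sup norm and passes through coordinates. *)
Lemma enorm_le_diameter {R : realType} {n : nat} (A : set 'rV[R]_n)
  (x y : 'rV[R]_n) : compact A -> A x -> A y -> enorm (x - y) <= diameter A.
Proof.
move=> /compact_bounded/pinfty_ex_gt0[M M0 AM] Ax Ay.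
apply: ub_le_sup; last by exists (x, y).
exists (Num.sqrt (n%:R * (M + M) ^+ 2)) => _ [[v w] [/= Av Aw] <-].
rewrite /enorm -sqr_enorm ler_wsqrtr//; apply: sqr_enorm_le => i.
rewrite !mxE (le_trans (ler_normB _ _))// lerD//.
  exact: le_trans (coord_le_mx_norm v i) (AM v Av).
exact: le_trans (coord_le_mx_norm w i) (AM w Aw).
Qed.

(** * Regret along a run of the algorithm *)

Section Regret.
Context {R : realType} {nX nZ nU : nat}.
Variables (X : set 'rV[R]_nX) (U : set 'rV[R]_nU).
Variables (F : 'rV[R]_nX -> 'rV[R]_nU -> 'rV[R]_nX).
Variables (Phi : 'rV[R]_nX -> 'rV[R]_nZ).
Variables (C : 'rV[R]_(nZ + nU) -> R).
Variables (gradC : 'rV[R]_(nZ + nU) -> 'rV[R]_(nZ + nU)) (L beta : R) (T : nat).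
Variables (x : nat -> 'rV[R]_nX) (u : nat -> 'rV[R]_nU).
Hypothesis XF : forall v w, X v -> U w -> X (F v w).
Hypothesis C_lip :
  lipschitz_gradient_on (convex_hull (prodset (Phi @` X) U)) C gradC L.
Hypothesis beta0 : 0 < beta.
Hypothesis run : algorithm_run X U F Phi C gradC L 0 beta T x u.

Let q := pair_at Phi x u.

Lemma run_in_domain (t : nat) : (t <= T)%N -> X (x t) /\ U (u t).
Proof.
case: run => X0 U0 xS um tT.
have Ut s : (s <= T)%N -> U (u s).
  by case: s => // s sT; have [] := um s.+1 sT.
split; last exact: Ut.
elim: t tT => // t IH tT; rewrite xS//; apply: XF; first exact/IH/ltnW.
exact/Ut/ltnW.
Qed.

Lemma regret_le (t i : nat) : (t <= T)%N -> (i < t)%N ->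
  regret U Phi C x u t <= L * enorm (q t - q i) ^+ 2.
Proof.
move=> tT it; pose H := convex_hull (prodset (Phi @` X) U).
have [Xt Ut] := run_in_domain t tT.
have Hpair s v : (s <= T)%N -> U v -> H (row_mx (Phi (x s)) v).
  move=> sT Uv K [_]; apply; rewrite /prodset /= row_mxKl row_mxKr.
  by split=> //; exists (x s) => //; case: (run_in_domain s sT).
have Hq s : (s <= T)%N -> H (q s).
  by move=> sT; apply: Hpair => //; case: (run_in_domain s sT).
have descent s : (s < t)%N -> forall y, H y ->
    `|C y - taylor1 C gradC y (q s)| <= L / 2 * enorm (y - q s) ^+ 2.
  move=> st y Hy; apply: (descent_lemma H) => //.
    exact: convex_set_convex_hull.
  by apply: Hq; apply: leq_trans tT; exact: ltnW.
have t0 : (0 < t)%N by apply: leq_ltn_trans it.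
have lowerC y : H y -> Cminus C gradC L q t y <= C y.
  move=> Hy; have low s : (s < t)%N -> lower_at C gradC L q y s <= C y.
    move=> st; have := descent s st y Hy; rewrite ler_norml /lower_at; lra.
  (* The first case is the initial value of the maximum, the term of index 0, a past time since
     [0 < t]. *)
  by apply: bigmax_le => [|s _]; apply: low.
(* As [alpha = 0], [beta] cancels and [u t] minimizes [Cminus], which lies below [C] at every
   competitor [v]. *)
have inf_ge : Cminus C gradC L q t (q t) <=
    inf [set C (row_mx (Phi (x t)) v) | v in U].
  apply: lb_le_inf; first by exists (C (q t)), (u t).
  move=> _ [v Uv <-]; case: run => _ _ _ /(_ t).
  rewrite t0 tT => /(_ isT)[_ umin].
  have := umin v Uv; rewrite /surrogate !mul0r !add0r ler_pM2l//.
  move=> /le_trans; apply.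
  by apply: lowerC; exact: Hpair.
have low_i : lower_at C gradC L q (q t) i <= Cminus C gradC L q t (q t).
  exact: (le_bigmax _ (fun s : 'I_t => lower_at C gradC L q (q t) s)
    (Ordinal it)).
(* The two errors, of [C] above its Taylor value and of [lower_at] below it, are [L / 2] each and
   add up to [L]. *)
have := descent i it (q t) (Hq t tT); rewrite ler_norml => /andP[_ up].
rewrite /regret -/q; move: low_i inf_ge up; rewrite /lower_at; lra.
Qed.

End Regret.

(* Mhat takes nZ, nU, L, G, alpha, beta and the diameters of Z and U.
   The smoothness of C is required on the convex hull of Z x U, which is Z x U
   itself when Z is convex; for a nonconvex Z, smoothness on Z x U alone does
   not make Cminus a lower bound of C. *)
Theorem corollary3 (R : realType) :
  exists Mhat : nat -> nat -> R -> R -> R -> R -> R -> R -> R,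
  forall (nX nZ nU : nat) (X : set 'rV[R]_nX) (U : set 'rV[R]_nU)
    (F : 'rV[R]_nX -> 'rV[R]_nU -> 'rV[R]_nX)
    (Phi : 'rV[R]_nX -> 'rV[R]_nZ)
    (C : 'rV[R]_(nZ + nU) -> R)
    (gradC : 'rV[R]_(nZ + nU) -> 'rV[R]_(nZ + nU))
    (L G alpha beta : R),
  let Z := Phi @` X in
  (nX <= nZ)%N -> (3 <= nZ + nU)%N ->
  convex_set X -> compact X ->
  convex_set U -> compact U ->
  compact Z ->
  (forall x u, X x -> U u -> X (F x u)) ->
  0 < L ->
  lipschitz_gradient_on (convex_hull (prodset Z U)) C gradC L ->
  0 < G ->
  (forall s, prodset Z U s -> enorm (gradC s) <= G) ->
  alpha = 0 -> 0 < beta ->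
  let M := Mhat nZ nU L G alpha beta (diameter Z) (diameter U) in
  0 < M /\
  forall (T : nat) (x : nat -> 'rV[R]_nX) (u : nat -> 'rV[R]_nU),
    (0 < T)%N ->
    algorithm_run X U F Phi C gradC L alpha beta T x u ->
    \sum_(1 <= t < T.+1) regret U Phi C x u t
      <= M * T%:R `^ (1 - 2 / (nZ + nU)%:R).
Proof.
(* The summand 1 makes the half-side of the cube positive and strictly larger than either diameter,
   as [qD] demands. *)
exists (fun nZ nU L _ _ _ dZ dU =>
  L * (48 * (nZ + nU)%:R * (`|dZ| + `|dU| + 1) ^+ 2)).
move=> nX nZ nU X U F Phi C gradC L G alpha beta Z _ n3 _ _ _ cU cZ XF L0 CL _ _
  -> beta0 M.
set D := `|diameter Z| + `|diameter U| + 1 in M *.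
have D0 : 0 < D by rewrite ltr_wpDl// addr_ge0.
split.
  by rewrite /M !mulr_gt0 ?exprn_gt0// ltr0n; apply: leq_trans n3.
move=> T x u T0 run.
apply: (sum_nearest_dist_le (pair_at Phi x u) D T) => //; last 2 first.
- exact: ltW.
- by move=> t i tT it; apply: (regret_le X U F Phi C gradC L beta T).
move=> t i tT.
have [X0 U0] := run_in_domain _ _ _ _ _ _ _ _ _ _ _ XF run 0 (leq0n T).
have [Xt Ut] := run_in_domain _ _ _ _ _ _ _ _ _ _ _ XF run t tT.
have DZ := normr_ge0 (diameter Z); have DU := normr_ge0 (diameter U).
(* Each coordinate belongs either to the context or to the control, and its variation is at most the
   corresponding diameter. *)
rewrite /pair_at !mxE; case: (fintype.split i) => j.
- apply: (@le_lt_trans _ _ (diameter Z)).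
    apply: le_trans (enorm_le_diameter Z (Phi (x t)) (Phi (x 0)) cZ _ _).
    + by apply: le_trans (coord_le_enorm _ j); rewrite !mxE.
    + by exists (x t).
    + by exists (x 0).
  by have := ler_norm (diameter Z); rewrite /D; lra.
- apply: (@le_lt_trans _ _ (diameter U)).
    apply: le_trans (enorm_le_diameter U (u t) (u 0) cU Ut U0).
    by apply: le_trans (coord_le_enorm _ j); rewrite !mxE.
  by have := ler_norm (diameter U); rewrite /D; lra.
Qed.
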